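(* Let $n\ge 2$, let $a\in\mathbb{Z}^n$ be a row vector with positive components whose greatest common divisor is $1$, and let $v\in\mathbb{R}^n$ be a column vector with $v\ge 0$. Suppose $\|a\|\ge 2^{(n/2+1)n}$. (1) Let $\beta_1,\beta_2$ be integers with $0\le\beta_1\le\beta_2\le av$, let $U$ be an $n\times n$ unimodular matrix such that the columns of $\begin{pmatrix} a\\ I\end{pmatrix}U$ are LLL-reduced, and let $$\tilde Q=\{\,y\in\mathbb{R}^n \mid \beta_1\le aUy\le\beta_2,\ 0\le Uy\le v\,\}.$$ Then $$\mathrm{iwidth}(e_n,\tilde Q)\ \le\ \big\lfloor f(a)\,(2\|v\|+(\beta_2-\beta_1))\big\rfloor+1 .$$ (2) Let $\beta$ be an integer with $0\le\beta\le av$, let $V$ be an integral $n\times(n-1)$ matrix whose columns form an LLL-reduced basis of the lattice $\mathbb{N}(a)=\{x\in\mathbb{Z}^n\mid ax=0\}$, let $x_\beta\in\mathbb{Z}^n$ satisfy $a x_\beta=\beta$, and let $$\hat Q=\{\,\lambda\in\mathbb{R}^{n-1}\mid -x_\beta\le V\lambda\le v-x_\beta\,\}.$$ Then $$\mathrm{iwidth}(e_{n-1},\hat Q)\ \le\ \lfloor 2g(a)\|v\|\rfloor+1 .$$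
   Context: $\|\cdot\|$ is the Euclidean norm, $I$ is the $n\times n$ identity matrix, and $e_i$ is the $i$th unit row vector (of length $n$ in part (1) and of length $n-1$ in part (2)). For an $n$-vector $a$, $$f(a)=\frac{2^{n/4}}{\|a\|^{1/n}},\qquad g(a)=\frac{2^{(n-2)/4}}{\|a\|^{1/(n-1)}} .$$ A square integral matrix $U$ is unimodular if $\det U=\pm1$. LLL-reducedness: linearly independent vectors $b_1,\dots,b_k$ with Gram–Schmidt orthogonalization $b_1^*,\dots,b_k^*$, i.e. $b_1=b_1^*$ and $b_i=b_i^*+\sum_{j<i}\mu_{ij}b_j^*$ with $\mu_{ij}=b_i^Tb_j^*/\|b_j^*\|^2$, are LLL-reduced if $|\mu_{ij}|\le 1/2$ for all $1\le j<i\le k$ and $\|b_i^*\|^2\le 2\|b_{i+1}^*\|^2$ for all $1\le i\le k-1$. A basis of a lattice is LLL-reduced if its vectors, in the given order, satisfy these conditions. For a polyhedron $Q$ and an integral row vector $c$, the integer width of $Q$ along $c$ is $$\mathrm{iwidth}(c,Q)=\lfloor\max\{cx\mid x\in Q\}\rfloor-\lceil\min\{cx\mid x\in Q\}\rceil+1 .$$ $\tilde Q$ is the feasible set of the LP-relaxation of the rangespace reformulation of the knapsack feasibility problem $\beta_1\le ax\le\beta_2,\ 0\le x\le v,\ x\in\mathbb{Z}^n$. $\hat Q$ is the feasible set of the LP-relaxation of the nullspace reformulation of the same problem with $\beta_1=\beta_2=\beta$. *)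

(* Defs.v *)
From mathcomp Require Import all_boot all_order all_algebra.
From mathcomp Require Import all_classical all_reals all_analysis.

Set Implicit Arguments.
Unset Strict Implicit.
Unset Printing Implicit Defensive.

Import Order.TTheory GRing.Theory Num.Theory.

Local Open Scope classical_set_scope.
Local Open Scope ring_scope.

Definition intmx (R : realType) m n (A : 'M[int]_(m, n)) : 'M[R]_(m, n) :=
  map_mx intr A.
Arguments intmx R {m n} A.

Definition mxle (R : realType) m n (A B : 'M[R]_(m, n)) : Prop :=
  forall i j, A i j <= B i j.

(* The library norm on matrices is the max norm. Used for rows and columns. *)
Definition enorm (R : realType) m n (A : 'M[R]_(m, n)) : R :=
  Num.sqrt (\sum_i \sum_j A i j ^+ 2).

(* [i] is numbered from 1, so that [unit_row k k] is the last unit row. *)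
Definition unit_row k (i : nat) : 'rV[int]_k := \row_(j < k) (j.+1 == i)%:R.

Definition f (R : realType) n (a : 'rV[R]_n) : R :=
  2 `^ (n%:R / 4) / enorm a `^ (n%:R^-1).

Definition g (R : realType) n (a : 'rV[R]_n) : R :=
  2 `^ ((n%:R - 2) / 4) / enorm a `^ ((n%:R - 1)^-1).

Definition unimodular n (U : 'M[int]_n) : Prop := \det U = 1 \/ \det U = -1.

Definition lin_indep_cols (R : realType) m k (B : 'M[R]_(m, k)) : Prop :=
  row_free B^T.

Section LLL.
Context (R : realType) (m k : nat).
Implicit Types B Bs : 'M[R]_(m, k).

Definition gs_coef B Bs (i j : 'I_k) : R :=
  ((col i B)^T *m col j Bs) 0 0 / enorm (col j Bs) ^+ 2.

(* The recurrence determines the columns of [Bs] one after the other. *)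
Definition gram_schmidt B Bs : Prop :=
  forall i : 'I_k,
    col i B = col i Bs + \sum_(j < k | (j < i)%N) gs_coef B Bs i j *: col j Bs.

Definition LLL_reduced B : Prop :=
  lin_indep_cols B /\
  exists Bs : 'M[R]_(m, k),
    [/\ gram_schmidt B Bs,
        forall i j : 'I_k, (j < i)%N -> `|gs_coef B Bs i j| <= 1 / 2
      & forall i i' : 'I_k, i' = i.+1 :> nat ->
          enorm (col i Bs) ^+ 2 <= 2 * enorm (col i' Bs) ^+ 2].

End LLL.

Definition null_lattice n (a : 'rV[int]_n) : set 'cV[int]_n :=
  [set x | a *m x = 0].

Definition lattice_basis (R : realType) n k
    (L : set 'cV[int]_n) (V : 'M[int]_(n, k)) : Prop :=
  lin_indep_cols (intmx R V) /\ L = [set V *m z | z in [set: 'cV[int]_k]].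
Arguments lattice_basis R {n k} L V.

Definition linear_values (R : realType) k
    (c : 'rV[int]_k) (Q : set 'cV[R]_k) : set R :=
  [set (intmx R c *m x) 0 0 | x in Q].

(* [sup] and [inf] are the maximum and minimum whenever these exist, see
   [iwidthE]; they do for any nonempty polytope [Q]. *)
Definition iwidth (R : realType) k (c : 'rV[int]_k) (Q : set 'cV[R]_k) : int :=
  Num.floor (sup (linear_values c Q)) - Num.ceil (inf (linear_values c Q)) + 1.

Lemma iwidthE (R : realType) k (c : 'rV[int]_k) (Q : set 'cV[R]_k) (M m : R) :
  linear_values c Q M -> ubound (linear_values c Q) M ->
  linear_values c Q m -> lbound (linear_values c Q) m ->
  iwidth c Q = Num.floor M - Num.ceil m + 1.
Proof.
move=> QM ubM Qm lbm; rewrite /iwidth.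
have -> : sup (linear_values c Q) = M.
  apply/le_anti/andP; split; first by apply: ge_sup => //; exists M.
  by apply: ub_le_sup => //; exists M.
have -> // : inf (linear_values c Q) = m.
apply/le_anti/andP; split; first by apply: ge_inf => //; exists m.
by apply: lb_le_inf => //; exists m.
Qed.

Definition rangespace_polyhedron (R : realType) n (a : 'rV[int]_n)
    (v : 'cV[R]_n) (beta1 beta2 : int) (U : 'M[int]_n) : set 'cV[R]_n :=
  [set y | [/\ beta1%:~R <= (intmx R (a *m U) *m y) 0 0,
               (intmx R (a *m U) *m y) 0 0 <= beta2%:~R,
               mxle 0 (intmx R U *m y)
             & mxle (intmx R U *m y) v]].

Definition nullspace_polyhedron (R : realType) n k (v : 'cV[R]_n)
    (xb : 'cV[int]_n) (V : 'M[int]_(n, k)) : set 'cV[R]_k :=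
  [set l | mxle (- intmx R xb) (intmx R V *m l) /\
           mxle (intmx R V *m l) (v - intmx R xb)].

(* Main.v *)
(** If [B] is LLL-reduced with Gram-Schmidt vectors [b_1*, ..., b_k*], then
[det (B^T B) = \prod_i |b_i*|^2 <= 2^(k(k-1)/2) |b_k*|^(2k)], and Parseval's
identity along the orthogonal family [b_i*] gives
[|y_k| |b_k*| <= |B y|]: the last coordinate of [y] is small as soon as
[det (B^T B)] is large and [|B y|] is small.  For differences [y] of two points
of the polyhedron, [|B y|] is bounded by the box and the knapsack constraints.
The Gram determinant is [1 + |a|^2] in the rangespace case, and [|a|^2] in the
nullspace case: completing a basis [V] of the null lattice by [x] with
[a x = 1] gives a unimodular matrix, whence [|det (a^T | V)| = |a|^2]. *)
Require Import Defs.
From mathcomp Require Import all_boot all_order all_algebra.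
From mathcomp Require Import all_classical all_reals all_analysis.
From mathcomp Require Import ring lra.

Set Implicit Arguments.
Unset Strict Implicit.
Unset Printing Implicit Defensive.

Import Order.TTheory GRing.Theory Num.Theory.

Local Open Scope ring_scope.

(** * Euclidean norm of rows, columns and stacked matrices *)

Section Enorm.
Context (R : realType).

Lemma enorm_ge0 m n (A : 'M[R]_(m, n)) : 0 <= enorm A.
Proof. exact: sqrtr_ge0. Qed.

Lemma sqr_enorm m n (A : 'M[R]_(m, n)) :
  enorm A ^+ 2 = \sum_i \sum_j A i j ^+ 2.
Proof.
by rewrite sqr_sqrtr// sumr_ge0// => i _; rewrite sumr_ge0// => j _; rewrite sqr_ge0.
Qed.

Lemma sqr_enorm_cV m (x : 'cV[R]_m) : enorm x ^+ 2 = (x^T *m x) 0 0.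
Proof.
rewrite sqr_enorm mxE; apply: eq_bigr => i _.
by rewrite big_ord1 !mxE expr2.
Qed.

Lemma sqr_enorm_rV m (x : 'rV[R]_m) : enorm x ^+ 2 = (x *m x^T) 0 0.
Proof.
rewrite sqr_enorm big_ord1 mxE; apply: eq_bigr => i _.
by rewrite !mxE expr2.
Qed.

Lemma enorm_col_mx m1 m2 n (A : 'M[R]_(m1, n)) (B : 'M[R]_(m2, n)) :
  enorm (col_mx A B) ^+ 2 = enorm A ^+ 2 + enorm B ^+ 2.
Proof.
rewrite !sqr_enorm big_split_ord /=.
by congr (_ + _); apply: eq_bigr => i _; apply: eq_bigr => j _;
  rewrite ?col_mxEu ?col_mxEd.
Qed.

Lemma le_enorm m n (A B : 'M[R]_(m, n)) :
  (forall i j, `|A i j| <= B i j) -> enorm A <= enorm B.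
Proof.
move=> AB; rewrite -(@ler_pXn2r _ 2) ?nnegrE ?enorm_ge0// !sqr_enorm.
apply: ler_sum => i _; apply: ler_sum => j _.
by rewrite -[leLHS]real_normK ?num_real// lerXn2r ?nnegrE// (le_trans _ (AB i j)).
Qed.

(** Two numbers in [[0, v_i]] differ by at most [v_i] in absolute value, so no factor 2 appears. *)
Lemma enorm_sub_box n (v x y : 'cV[R]_n) :
  (forall i, 0 <= x i 0 <= v i 0) -> (forall i, 0 <= y i 0 <= v i 0) ->
  enorm (x - y) <= enorm v.
Proof.
move=> xv yv; apply: le_enorm => i j; rewrite (ord1 j) !mxE ler_norml.
by have /andP[? ?] := xv i; have /andP[? ?] := yv i; apply/andP; split; lra.
Qed.

End Enorm.

(** * Gram-Schmidt factorization and the Gram determinant *)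

Section GramSchmidt.
Context (R : realType) (m k : nat) (B Bs : 'M[R]_(m, k)).
Hypothesis BBs : gram_schmidt B Bs.

(** Strong induction on the larger index: [b_i*] is [b_i] minus its projections, and in the product
    with [b_j*] only the [j]-th projection survives, cancelling [b_i]. *)
Lemma gram_schmidt_orthogonal_lt (i j : 'I_k) :
  (j < i)%N -> ((col i Bs)^T *m col j Bs) 0 0 = 0.
Proof.
have sym l p : ((col l Bs)^T *m col p Bs) 0 0 = ((col p Bs)^T *m col l Bs) 0 0.
  by rewrite !mxE; apply: eq_bigr => q _; rewrite !mxE mulrC.
have [p] := ubnP (i : nat); elim: p i j => // p IH i j ip ji.
have -> : col i Bs = col i B - \sum_(l < k | (l < i)%N) gs_coef B Bs i l *: col l Bs.
  by rewrite (BBs i) addrK.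
rewrite linearB/= mulmxBl mxE [X in _ + X]mxE linear_sum/= mulmx_suml summxE.
rewrite (bigD1 j)//= big1 => [|l /andP[li lj]].
  rewrite addr0 linearZ/= -scalemxAl [X in _ - X]mxE -sqr_enorm_cV /gs_coef.
  (* If [b_j*] has norm zero, the coefficient is a division by zero and cancels nothing, but then
     [b_j*] itself vanishes. *)
  have [j0|j0] := eqVneq (enorm (col j Bs) ^+ 2) 0; last by rewrite divfK// subrr.
  rewrite j0 mulr0 subr0; suff -> : col j Bs = 0 by rewrite mulmx0 mxE.
  apply/colP => q; rewrite [RHS]mxE; apply/eqP; rewrite -sqrf_eq0; apply/eqP.
  move: j0; rewrite sqr_enorm => /eqP; rewrite psumr_eq0 => [/allP/(_ q)|q' _].
    by rewrite mem_index_enum big_ord1 => /(_ isT)/eqP.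
  by rewrite big_ord1 sqr_ge0.
rewrite linearZ/= -scalemxAl mxE.
(* The larger of [l] and [j] is still below [i], so the induction hypothesis applies to the ordered
   pair. *)
have [lj'|jl|/val_inj lj'] := ltngtP (l : nat) (j : nat).
- by rewrite sym (IH j l) ?mulr0//; apply: leq_trans ji _.
- by rewrite (IH l j) ?mulr0//; apply: leq_trans li _.
- by rewrite lj' eqxx in lj.
Qed.

(** Transpose of the matrix of the [mu_ij], with unit diagonal, so that it acts on [Bs] from the
    right. *)
Definition gs_mx : 'M[R]_k :=
  \matrix_(j, i) (if (j < i)%N then gs_coef B Bs i j else (j == i)%:R).

Lemma gram_schmidt_mulmx : B = Bs *m gs_mx.
Proof.
apply/matrixP => p i; have /colP/(_ p) := BBs i; rewrite !mxE => ->.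
rewrite [RHS](bigD1 i)//= !mxE ltnn eqxx mulr1; congr (_ + _).
rewrite summxE big_mkcond [RHS]big_mkcond/=; apply: eq_bigr => j _; rewrite !mxE.
have [->|ji] := eqVneq j i; first by rewrite ltnn.
by case: ifP => _; rewrite ?mulr0//= mulrC.
Qed.

Lemma gram_schmidt_gram :
  Bs^T *m Bs = diag_mx (\row_i enorm (col i Bs) ^+ 2).
Proof.
have E i j : (Bs^T *m Bs) i j = ((col i Bs)^T *m col j Bs) 0 0.
  by rewrite !mxE; apply: eq_bigr => q _; rewrite !mxE.
apply/matrixP => i j; rewrite E mxE mxE.
have [ij|ji|/val_inj ->] := ltngtP (i : nat) (j : nat).
- rewrite (_ : (i == j) = false) ?mulr0n; last by apply/negP => /eqP ij'; rewrite ij' ltnn in ij.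
  rewrite -[RHS](gram_schmidt_orthogonal_lt ij) !mxE.
  by apply: eq_bigr => q _; rewrite !mxE mulrC.
- rewrite (_ : (i == j) = false) ?mulr0n; last by apply/negP => /eqP ij'; rewrite ij' ltnn in ji.
  by rewrite -[RHS](gram_schmidt_orthogonal_lt ji) mxE.
- by rewrite eqxx mulr1n [RHS]mxE sqr_enorm_cV mxE.
Qed.

Lemma det_gs_mx : \det gs_mx = 1.
Proof.
rewrite -det_tr det_trig.
  by rewrite big1// => i _; rewrite !mxE ltnn eqxx.
apply/is_trig_mxP => i j ij; rewrite !mxE ltnNge (ltnW ij)/=.
by rewrite (_ : (j == i) = false)//; apply/negP => /eqP ij'; rewrite ij' ltnn in ij.
Qed.

Lemma det_gram : \det (B^T *m B) = \prod_i enorm (col i Bs) ^+ 2.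
Proof.
rewrite [in LHS]gram_schmidt_mulmx trmx_mul mulmxA -[_ *m _ *m Bs]mulmxA gram_schmidt_gram.
rewrite !det_mulmx det_tr det_gs_mx mul1r mulr1 det_diag.
by apply: eq_bigr => i _; rewrite mxE.
Qed.

Lemma parseval (y : 'cV[R]_k) :
  enorm (B *m y) ^+ 2
  = \sum_i enorm (col i Bs) ^+ 2 * (gs_mx *m y) i 0 ^+ 2.
Proof.
rewrite sqr_enorm_cV [in LHS]gram_schmidt_mulmx -!mulmxA trmx_mul -mulmxA.
rewrite (mulmxA Bs^T) gram_schmidt_gram; move: (gs_mx *m y) => c; rewrite mxE.
by apply: eq_bigr => i _; rewrite mul_diag_mx !mxE mulrCA expr2.
Qed.

End GramSchmidt.

(** * Last coordinate in an LLL-reduced basis *)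

Section LLLBound.
Context (R : realType) (m k : nat) (B : 'M[R]_(m, k.+1)).

(** Iteration gives [D i <= 2^(k-i) D k], and the exponents sum to [k(k+1)/2]; powers of the square
    root of 2 avoid the halving. *)
Lemma geometric_prod_le (D : nat -> R) :
  (forall i, 0 <= D i) -> (forall i, (i < k)%N -> D i <= 2 * D i.+1) ->
  \prod_(i < k.+1) D i <= Num.sqrt (2 : R) ^+ (k * k.+1) * D k ^+ k.+1.
Proof.
move=> D0; elim: k => [|l IH] DS; first by rewrite big_ord1 mul0n expr0 mul1r expr1.
have /IH {}IH : forall i, (i < l)%N -> D i <= 2 * D i.+1.
  by move=> i il; apply: DS; apply: ltnW.
rewrite big_ord_recr /= exprSr mulrA ler_wpM2r//; apply: le_trans IH _.
have -> : (l.+1 * l.+2 = l * l.+1 + 2 * l.+1)%N by ring.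
rewrite exprD -mulrA ler_wpM2l ?exprn_ge0 ?sqrtr_ge0//.
by rewrite exprM sqr_sqrtr// -exprMn lerXn2r ?nnegrE ?mulr_ge0// DS.
Qed.

(** [N] is only a lower bound for the square root of the Gram determinant, so that [N = |a|] serves
    both reformulations. *)
Lemma LLL_reduced_last_coord (N : R) (y : 'cV[R]_k.+1) :
  LLL_reduced B -> 0 < N -> N ^+ 2 <= \det (B^T *m B) ->
  `|y ord_max 0| <= 2 `^ (k%:R / 4) / N `^ (k.+1%:R^-1) * enorm (B *m y).
Proof.
move=> [_ [Bs [BBs _ lovasz]]] N0 Ndet.
set d := enorm (col ord_max Bs).
have d0 : 0 <= d by exact: enorm_ge0.
have yd : `|y ord_max 0| * d <= enorm (B *m y).
  rewrite -(@ler_pXn2r _ 2) ?nnegrE ?mulr_ge0 ?enorm_ge0// (parseval BBs).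
  rewrite (bigD1 ord_max)//= exprMn real_normK ?num_real// mulrC.
  (* The last row of the unit upper triangular [gs_mx] is the last unit row. *)
  have -> : (gs_mx B Bs *m y) ord_max 0 = y ord_max 0.
    rewrite mxE (bigD1 ord_max)//= mxE ltnn eqxx mul1r big1 ?addr0// => j jk.
    by rewrite mxE ltnNge -ltnS ltn_ord/= eq_sym (negbTE jk) mul0r.
  by rewrite lerDl sumr_ge0// => i _; rewrite mulr_ge0 ?sqr_ge0.
have Nd : N ^+ 2 <= Num.sqrt (2 : R) ^+ (k * k.+1) * (d ^+ 2) ^+ k.+1.
  apply: le_trans Ndet _; rewrite (det_gram BBs).
  pose D i := enorm (col (inord i) Bs) ^+ 2.
  rewrite (eq_bigr (fun i : 'I_k.+1 => D i)); last first.
    by move=> i _; rewrite /D inord_val.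
  have -> : d = enorm (col (inord k) Bs).
    by rewrite /d; congr (enorm (col _ _)); apply/val_inj; rewrite /= inordK.
  apply: geometric_prod_le => [i|i ik]; first exact: sqr_ge0.
  by apply: lovasz; rewrite !inordK// ltnS ltnW.
set M := N `^ _; set t := 2 `^ _.
have M0 : 0 < M by rewrite powR_gt0.
have Md : M <= t * d.
  (* The power [2(k+1)] turns the claim into [Nd], since [(2^(k/4))^(2(k+1)) = 2^(k(k+1)/2)]. *)
  rewrite -(@ler_pXn2r _ (2 * k.+1))// ?nnegrE ?mulr_ge0 ?powR_ge0// exprMn.
  have -> : M ^+ (2 * k.+1) = N ^+ 2.
    rewrite mulnC exprM; congr (_ ^+ 2).
    by rewrite -powR_mulrn ?powR_ge0// -powRrM mulVf ?pnatr_eq0// powRr1// ltW.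
  suff -> : t ^+ (2 * k.+1) = Num.sqrt (2 : R) ^+ (k * k.+1) by rewrite (exprM d).
  rewrite -powR12_sqrt// -!powR_mulrn ?powR_ge0// -!powRrM; congr (2 `^ _).
  by rewrite !natrM; field.
have -> : t / M * enorm (B *m y) = (t * enorm (B *m y)) / M by ring.
rewrite ler_pdivlMr//; apply: (@le_trans _ _ (`|y ord_max 0| * (t * d))).
  by rewrite ler_wpM2l.
by rewrite mulrCA ler_wpM2l ?powR_ge0.
Qed.

End LLLBound.

(** * Integer width from bounds on differences *)

Lemma unit_row_last (R : realType) k (x : 'cV[R]_k.+1) :
  (intmx R (unit_row k.+1 k.+1) *m x) 0 0 = x ord_max 0.
Proof.
rewrite mxE (bigD1 ord_max)//= !mxE eqxx mul1r big1 ?addr0// => j jk.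
rewrite !mxE eqSS (_ : (j == k :> nat) = false) ?mul0r//.
by apply/negbTE; apply: contraNneq jk => jk; apply/eqP/val_inj.
Qed.

Section Iwidth.
Local Open Scope classical_set_scope.

(** The floor of the supremum minus the ceiling of the infimum is an integer below [D], hence below
    its floor. *)
Lemma iwidth_le (R : realType) k (c : 'rV[int]_k) (Q : set 'cV[R]_k) (D : R) :
  0 <= D ->
  (forall x y, Q x -> Q y ->
     (intmx R c *m x) 0 0 - (intmx R c *m y) 0 0 <= D) ->
  iwidth c Q <= Num.floor D + 1.
Proof.
move=> D0 QD; rewrite /iwidth lerD2r.
(* For empty [Q], [sup] and [inf] default to 0 and the width is 1; here [0 <= D] decides. *)
have [->|/set0P[_ [x0 Qx0 _]]] := eqVneq (linear_values c Q) set0.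
  by rewrite sup0 inf0 floor0 ceil0 subrr floor_ge_int.
set S := linear_values c Q.
have S0 : S !=set0 by exists ((intmx R c *m x0) 0 0); exists x0.
have SD s : S s -> s - D <= inf S.
  move=> [x Qx <-]; apply: lb_le_inf => // _ [y Qy <-].
  by have := QD _ _ Qx Qy; lra.
have supD : sup S - inf S <= D.
  suff : sup S <= D + inf S by lra.
  by apply: ge_sup => // s /SD; lra.
rewrite floor_ge_int intrB; apply: le_trans supD.
by apply: lerB; [exact: Num.Theory.floor_le | exact: ceil_ge].
Qed.

End Iwidth.

(** * Bezout coefficients and the two Gram determinants *)

Lemma bezout_ord n (F : 'I_n -> int) :
  exists z : 'I_n -> int, \sum_i F i * z i = (\big[gcdn/0%N]_i absz (F i))%:Z.
Proof.
elim: n F => [|n IH] F; first by exists (fun=> 0); rewrite !big_ord0.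
have [z zE] := IH (F \o lift ord0).
rewrite big_ord_recl; set G := (\big[_/_]_(i < n) _)%N.
have [u [w uwE]] := Bezoutz (F ord0) G%:Z.
(* The head gets [u]; the coefficients of the tail are scaled by [w]. *)
exists (fun i => if unlift ord0 i is Some j then w * z j else u).
rewrite big_ord_recl unlift_none.
under eq_bigr do rewrite liftK mulrCA.
by rewrite -mulr_sumr zE mulrC uwE.
Qed.

Section Determinants.

(** One block matrix is factored into triangular blocks in two orders; each order exposes one
    side. *)
Lemma sylvester_det (R : comNzRingType) m n (A : 'M[R]_(m, n)) (B : 'M[R]_(n, m)) :
  \det (1%:M + B *m A) = \det (1%:M + A *m B).
Proof.
have E1 : block_mx 1%:M (- A) B 1%:M
  = block_mx 1%:M 0 B 1%:M *m block_mx 1%:M (- A) 0 (1%:M + B *m A).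
  rewrite mulmx_block !mul1mx !mul0mx !mulmx1 !addr0 mulmxN.
  by rewrite addrC addrK.
have E2 : block_mx 1%:M (- A) B 1%:M
  = block_mx (1%:M + A *m B) (- A) 0 1%:M *m block_mx 1%:M 0 B 1%:M.
  rewrite mulmx_block !mul1mx !mul0mx !mulmx1 !mulmx0 !add0r mulNmx.
  by rewrite addrK.
move: (etrans (esym E1) E2) => /(congr1 determinant).
by rewrite !det_mulmx !det_ublock !det_lblock !det1 !mul1r !mulr1.
Qed.

(** The Gram matrix is [U^T (I + a^T a) U]; [det U] squares to 1, and Sylvester's identity leaves a
    1 by 1 determinant. *)
Lemma det_rangespace_gram (R : realType) n (a : 'rV[int]_n) (U : 'M[int]_n) :
  unimodular U ->
  \det ((intmx R (col_mx a 1%:M *m U))^T *m intmx R (col_mx a 1%:M *m U))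
  = 1 + enorm (intmx R a) ^+ 2.
Proof.
move=> U1; rewrite /intmx map_mxM map_col_mx map_mx1 -/(intmx R a) -/(intmx R U).
rewrite trmx_mul mulmxA -[_ *m _ *m col_mx _ _]mulmxA tr_col_mx mul_row_col.
rewrite trmx1 mulmx1 !det_mulmx det_tr mulrAC det_map_mx.
have -> : (\det U)%:~R * (\det U)%:~R = 1 :> R.
  by case: U1 => ->; rewrite ?mulr1// -intrM mulrNN mulr1.
by rewrite mul1r addrC sylvester_det det_mx11 mxE mxE eqxx sqr_enorm_rV.
Qed.

Lemma det_nullspace_gram (R : realType) n (a : 'rV[int]_n.+1)
    (V : 'M[int]_(n.+1, n)) :
  a != 0 -> \big[gcdn/0%N]_i absz (a 0 i) = 1%N ->
  lattice_basis R (null_lattice a) V ->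
  \det ((intmx R V)^T *m intmx R V) = enorm (intmx R a) ^+ 2.
Proof.
move=> a0 a1 [_ VE].
have [x ax] : exists x : 'cV[int]_n.+1, a *m x = 1%:M.
  have [z zE] := bezout_ord (fun i => a 0 i).
  exists (\col_i z i); rewrite [LHS]mx11_scalar mxE; congr (_%:M).
  by move: zE; rewrite a1 => zE; rewrite -[RHS]zE; apply: eq_bigr => i _; rewrite mxE.
have aV : a *m V = 0.
  apply/row_matrixP => i; rewrite row0; apply/rowP => j.
  have : null_lattice a (V *m delta_mx j 0) by rewrite VE; exists (delta_mx j 0).
  rewrite /null_lattice/= mulmxA -colE => /colP/(_ 0); rewrite mxE [RHS]mxE => aVj.
  by rewrite mxE (ord1 i) aVj mxE.
(* As [a x = 1], subtracting [x (a w)] moves [w] into the null lattice. *)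
have decomp (w : 'cV[int]_n.+1) : exists z, w = x *m (a *m w) + V *m z.
  have : null_lattice a (w - x *m (a *m w)).
    by rewrite /null_lattice/= mulmxBr (mulmxA a x) ax mul1mx subrr.
  by rewrite VE => -[z _ zE]; exists z; rewrite zE addrC subrK.
pose W : 'M[int]_n.+1 := row_mx x V : 'M[int]_(n.+1, 1 + n).
(* By [decomp] the columns of [W] generate all unit vectors, so [W] has an integral right inverse
   and its determinant is a unit of the integers. *)
have W1 : \det W * \det W = 1.
  have /fin_all_exists[z zE] : forall j : 'I_n.+1, exists z : 'cV[int]_(1 + n),
      delta_mx j 0 = (row_mx x V : 'M[int]_(n.+1, 1 + n)) *m z.
    move=> j; have [z zE] := decomp (delta_mx j 0).
    by exists (col_mx (a *m delta_mx j 0) z); rewrite mul_row_col.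
  have WZ : W *m \matrix_(i, j) z j i 0 = 1%:M.
    apply/matrixP => i j; have /colP/(_ i) := zE j; rewrite !mxE andbT => ->.
    by apply: eq_bigr => l _; rewrite !mxE.
  have : \det W \is a GRing.unit.
    by apply/unitrPr; exists (\det (\matrix_(i, j) z j i 0)); rewrite -det_mulmx WZ det1.
  by rewrite qualifE/= => /orP[] /eqP ->; rewrite ?mulr1 ?mulrNN ?mulr1.
(* Decomposing [a^T] itself writes [(a^T | V)] as [W] times a block lower triangular matrix of
   determinant [a a^T]. *)
have [t tE] := decomp a^T.
pose M : 'M[int]_n.+1 := row_mx a^T V : 'M[int]_(n.+1, 1 + n).
have ME : M = W *m (block_mx (a *m a^T) 0 t 1%:M : 'M[int]_(1 + n)).
  have := mul_row_block x V (a *m a^T) 0 t 1%:M.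
  by rewrite mulmx0 add0r mulmx1 -tE => /esym.
have detM : \det M = \det W * (a *m a^T) 0 0.
  by rewrite ME det_mulmx (det_lblock (a *m a^T)) det1 mulr1 det_mx11.
have MM : M^T *m M = (block_mx (a *m a^T) 0 0 (V^T *m V) : 'M[int]_(1 + n)).
  suff : (row_mx a^T V)^T *m row_mx a^T V = block_mx (a *m a^T) 0 0 (V^T *m V) by [].
  by rewrite tr_row_mx mul_col_row trmxK aV -trmx_mul aV trmx0.
have aa0 : (a *m a^T) 0 0 != 0.
  apply: contra_neq a0 => aa0; apply/rowP => i; rewrite mxE.
  move: aa0 => /eqP; rewrite mxE psumr_eq0 => [/allP/(_ i)|j _].
    by rewrite mem_index_enum !mxE mulf_eq0 orbb => /(_ isT)/eqP.
  by rewrite !mxE -expr2 sqr_ge0.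
(* The same determinant is also [(det M)^2 = (a a^T)^2]; cancelling [a a^T] leaves the claim. *)
have : \det (M^T *m M) = (a *m a^T) 0 0 * \det (V^T *m V).
  by rewrite MM (det_lblock (a *m a^T)) det_mx11.
rewrite det_mulmx det_tr detM mulrACA W1 mul1r => /(mulfI aa0) detV.
rewrite sqr_enorm_rV /intmx !map_trmx -!map_mxM det_map_mx -detV.
by rewrite [RHS]mxE.
Qed.

End Determinants.

Theorem theorem1 (R : realType) (n : nat) (a : 'rV[int]_n) (v : 'cV[R]_n)
    (hn : (2 <= n)%N)
    (ha_pos : forall i : 'I_n, 0 < a 0 i)
    (ha_gcd : \big[gcdn/0%N]_(i < n) absz (a 0 i) = 1%N)
    (hv : mxle 0 v)
    (ha_norm : 2 `^ ((n%:R / 2 + 1) * n%:R) <= enorm (intmx R a)) :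
  (forall (beta1 beta2 : int) (U : 'M[int]_n),
      0 <= beta1 -> beta1 <= beta2 ->
      beta2%:~R <= (intmx R a *m v) 0 0 ->
      unimodular U ->
      LLL_reduced (intmx R (col_mx a 1%:M *m U)) ->
      iwidth (unit_row n n) (rangespace_polyhedron a v beta1 beta2 U)
        <= Num.floor (f (intmx R a) * (2 * enorm v + (beta2 - beta1)%:~R)) + 1)
  /\
  (forall (beta : int) (V : 'M[int]_(n, n.-1)) (xb : 'cV[int]_n),
      0 <= beta ->
      beta%:~R <= (intmx R a *m v) 0 0 ->
      lattice_basis R (null_lattice a) V ->
      LLL_reduced (intmx R V) ->
      a *m xb = beta%:M ->
      iwidth (unit_row n.-1 n.-1) (nullspace_polyhedron v xb V)
        <= Num.floor (2 * g (intmx R a) * enorm v) + 1).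
Proof.
have N0 : 0 < enorm (intmx R a) by apply: lt_le_trans ha_norm; rewrite powR_gt0.
case: n hn a v ha_pos ha_gcd hv {ha_norm} N0 => [|[|n]]// _ a v ha_pos ha_gcd hv N0.
have v0 := enorm_ge0 v.
split.
- move=> b1 b2 U _ b12 _ U1 LLL.
  have b0 : (0 : R) <= (b2 - b1)%:~R by rewrite ler0z subr_ge0.
  have f0 : 0 <= f (intmx R a) by rewrite divr_ge0 ?powR_ge0.
  apply: iwidth_le => [|x y [x1 x2 x3 x4] [y1 y2 y3 y4]].
    by rewrite mulr_ge0// addr_ge0// mulr_ge0.
  rewrite !unit_row_last.
  have -> : x ord_max 0 - y ord_max 0 = (x - y) ord_max 0 by rewrite !mxE.
  apply: le_trans (ler_norm _) _.
  apply: le_trans (@LLL_reduced_last_coord _ _ _ _ _ (x - y) LLL N0 _) _.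
    by rewrite det_rangespace_gram// lerDr.
  (* In dimension [n.+2] the lattice bound has exponent [(n+1)/4], below the [(n+2)/4] in [f]. *)
  apply: ler_pM; rewrite ?enorm_ge0 ?divr_ge0 ?powR_ge0//.
    rewrite ler_wpM2r ?invr_ge0 ?powR_ge0// ler_powR ?ler1n//.
    by rewrite ler_wpM2r ?invr_ge0// ler_nat.
  rewrite -(@ler_pXn2r _ 2) ?nnegrE ?enorm_ge0 ?addr_ge0 ?mulr_ge0//.
  rewrite {1}/intmx mul_col_mx mul1mx map_col_mx mul_col_mx enorm_col_mx.
  have bxy : enorm (intmx R (a *m U) *m (x - y)) ^+ 2 <= (b2 - b1)%:~R ^+ 2.
    rewrite sqr_enorm !big_ord1 mulmxBr mxE [X in _ + X]mxE.
    rewrite -[leLHS]real_normK ?num_real// lerXn2r ?nnegrE//.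
    by rewrite ler_norml intrB; apply/andP; split; lra.
  have vxy : enorm (intmx R U *m (x - y)) ^+ 2 <= enorm v ^+ 2.
    rewrite lerXn2r ?nnegrE ?enorm_ge0// mulmxBr; apply: enorm_sub_box => i.
      by have := x3 i 0; rewrite [X in X <= _ -> _]mxE => ->; apply: x4.
    by have := y3 i 0; rewrite [X in X <= _ -> _]mxE => ->; apply: y4.
  (* For nonnegative [s] and [d], [d^2 + s^2 <= (2s + d)^2]. *)
  apply: le_trans (lerD bxy vxy) _; nra.
- move=> b V xb _ _ VB LLL _.
  have a0 : a != 0.
    by apply/eqP => a0; have := ha_pos 0; rewrite a0 mxE ltxx.
  have g0 : 0 <= g (intmx R a) by rewrite divr_ge0 ?powR_ge0.
  (* Translating by [xb] lands in the box [[0, v]]; the shift cancels in differences. *)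
  have box z : nullspace_polyhedron v xb V z ->
      forall i, 0 <= (intmx R V *m z + intmx R xb) i 0 <= v i 0.
    move=> [z1 z2] i; rewrite mxE; apply/andP; split.
      by have := z1 i 0; rewrite [leLHS]mxE; lra.
    by have := z2 i 0; rewrite [leRHS]mxE [X in _ <= _ + X]mxE; lra.
  apply: iwidth_le => [|x y Qx Qy]; first by rewrite mulr_ge0// mulr_ge0.
  rewrite !unit_row_last.
  have -> : x ord_max 0 - y ord_max 0 = (x - y) ord_max 0 by rewrite !mxE.
  apply: le_trans (ler_norm _) _.
  apply: le_trans (@LLL_reduced_last_coord _ _ _ _ _ (x - y) LLL N0 _) _.
    by rewrite (det_nullspace_gram a0 ha_gcd VB).
  (* With [n.+2] variables [V] has [n.+1] columns, so the constant is exactly [g]. *)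
  have -> : 2 `^ (n%:R / 4) / enorm (intmx R a) `^ (n.+1%:R^-1) = g (intmx R a).
    rewrite /g (_ : n.+2%:R - 1 = n.+1%:R); last by rewrite -natr1 addrK.
    by rewrite (_ : n.+2%:R - 2 = n%:R)// -[n.+2]addn2 natrD addrK.
  have vxy : enorm (intmx R V *m (x - y)) <= enorm v.
    have -> : intmx R V *m (x - y)
        = (intmx R V *m x + intmx R xb) - (intmx R V *m y + intmx R xb).
      by rewrite mulmxBr opprD addrACA subrr addr0.
    by apply: enorm_sub_box; apply: box.
  apply: (@le_trans _ _ (g (intmx R a) * enorm v)); first by rewrite ler_wpM2l.
  have := mulr_ge0 g0 v0; lra.
Qed.
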